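(* Let $n\ge 2$ be an integer and $N=2^n+2$. A set $A\subseteq \mathbb{Z}/N\mathbb{Z}$ of cardinality $n$ is sumset-distinct modulo $N$ if and only if at least one of the following holds: (i) there exist an odd integer $a$ and a finite set $A'$ of integers that is sumset-distinct modulo $N/2$ such that $A$ is the set of residues modulo $N$ of $\{a\}\cup 2A'$, where $2A'=\{2x: x\in A'\}$; (ii) there exists a finite set $A'$ of integers that is sumset-distinct modulo $N/2$ such that $A$ is the set of residues modulo $N$ of $\{N/2\}\cup A'$. In particular, the number of such sets $A\subseteq\mathbb{Z}/N\mathbb{Z}$ is $O(N^3)$ (with an absolute implied constant).
   Context: A finite set of integers (or of residues modulo $M$) is called sumset-distinct modulo $M$ if all of its subsets (including the empty set, whose sum is $0$) have pairwise distinct sums modulo $M$. *)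

(* Defs.v *)
From HB Require Import structures.
From mathcomp Require Import all_boot all_order all_algebra.
From mathcomp Require Import finmap.

Set Implicit Arguments.
Unset Strict Implicit.
Unset Printing Implicit Defensive.

Import GRing.Theory.
Local Open Scope ring_scope.
Local Open Scope fset_scope.

Definition intset_sumset_distinct (M : nat) (A : {fset int}) : Prop :=
  forall B C : {fset int}, B `<=` A -> C `<=` A ->
  (\sum_(x <- B) x = \sum_(x <- C) x %[mod M])%Z -> B = C.

(* 'Z_M is Z/MZ only for 1 < M. *)
Definition sumset_distinct (M : nat) (A : {set 'Z_M}) : bool :=
  [forall B : {set 'Z_M}, forall C : {set 'Z_M},
    [&& B \subset A, C \subset A & \sum_(x in B) x == \sum_(x in C) x]
      ==> (B == C)].

Definition residues (M : nat) (S : {fset int}) : {set 'Z_M} :=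
  [set y in [seq (x%:~R : 'Z_M) | x <- S]].

Definition bigN (n : nat) : nat := (2 ^ n + 2)%N.

(* Main.v *)
Require Import Defs.
From HB Require Import structures.
From mathcomp Require Import all_boot all_order all_algebra.
From mathcomp Require Import all_fingroup all_solvable all_field.
From mathcomp Require Import finmap zify ring lra.

Set Implicit Arguments.
Unset Strict Implicit.
Unset Printing Implicit Defensive.

Import GRing.Theory Num.Theory Order.TTheory.
Local Open Scope ring_scope.

(** Write [N = 2M], so [M = 2 ^ (n - 1) + 1] is odd. A set [A] of [n] residues with
distinct subset sums represents all residues modulo [N] but two, [u] and [v], so
that modulo ['X^N - 1], up to the sum of all powers of ['X],
the product of the [1 + 'X^a] for [a] in [A] is [- ('X^u + 'X^v)]
([generating_polynomial]).

Evaluating at [-1] shows that [A] has an odd member and that [d = v - u] is odd.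
Let [g] be the gcd of [d] and [M]. Evaluating at a complex root of unity of order
[2g], where the right-hand side vanishes, gives an odd member [a1] divisible by [g]
([odd_multiple_member]). If [g = M] then [a1 = M], which is alternative (ii).
Otherwise take a prime [p] dividing [M / g] and let [p^j] be the exact power of [p]
dividing [g], which is also the one dividing [d]. Over ['F_p], [-1] is a root of
[1 + 'X^d] of multiplicity exactly [p^j], and a root of the product of multiplicity
at least [p^j] because of [a1], plus one for every other odd member. So [a1] is the
only odd member, which is alternative (i) ([odd_member_unique]). In both cases the
other members have distinct subset sums modulo [M], and the converse implications
are elementary.

For the count, those other members are [m = n - 1] elements with distinct sums in a
group of order [2 ^ m + 1], where only one element [u] is not a sum. If [a] is one of
them and [B] the set of sums of the others, then [B] and [B + a] tile the group minus
[u]; as the order is odd, [a] generates the group and [B] is an arithmetic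
progression of [2 ^ (m - 1)] terms with difference [2a]. Removing another element
[b], the progression is tiled by two translates at distance [b], whence
[b = +- 2 ^ i a] with [i < m] ([power_of_two_structure]). So the members are
determined modulo [M] by one of them and [m] signs. In alternative (i) they are even,
hence known modulo [N], and [a1] is arbitrary; in alternative (ii) each of them has
two lifts modulo [N], and [a1] is fixed. Both give O(N^3) sets. *)

(** * Distinct subset sums *)

(** Families rather than sets, so that distinctness of the sums of a set
of residues modulo [N], read modulo a divisor of [N], is an instance. *)
Definition distinct_sums (I : finType) (V : zmodType) (f : I -> V) (A : {set I}) : Prop :=
  {in powerset A &, injective (fun B : {set I} => \sum_(i in B) f i)}.

Definition sum_set (I : finType) (V : finZmodType) (f : I -> V) (A : {set I}) : {set V} :=
  [set \sum_(i in B) f i | B : {set I} in powerset A].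

Lemma distinct_sumsS (I : finType) (V : zmodType) (f : I -> V) (A B : {set I}) :
  B \subset A -> distinct_sums f A -> distinct_sums f B.
Proof.
move=> sBA dA X Y; rewrite !powersetE => XB YB.
by apply: dA; rewrite powersetE; apply: subset_trans sBA.
Qed.

Lemma card_sum_set (I : finType) (V : finZmodType) (f : I -> V) (A : {set I}) :
  distinct_sums f A -> #|sum_set f A| = (2 ^ #|A|)%N.
Proof. by move=> dA; rewrite card_in_imset // card_powerset. Qed.

(** A sum equal to [t] either omits [a] or uses it; distinctness forbids
both at once, which makes the disjunction exclusive. *)
Lemma sum_setD1 (I : finType) (V : finZmodType) (f : I -> V) (A : {set I}) a t :
  a \in A -> distinct_sums f A ->
  (t \in sum_set f A) =
  (t \in sum_set f (A :\ a)) (+) (t - f a \in sum_set f (A :\ a)).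
Proof.
move=> aA dA.
have sub1 (B : {set I}) : B \in powerset (A :\ a) -> (B \in powerset A) * (a \notin B).
  by rewrite !powersetE subsetD1 => /andP[-> ->].
have sub2 (B : {set I}) : B \in powerset (A :\ a) -> a |: B \in powerset A.
  by move=> /sub1[]; rewrite !powersetE subUset sub1set aA.
apply/idP/idP.
- case/imsetP=> B BA ->; have [aB|aB] := boolP (a \in B); last first.
    have BA' : B \in powerset (A :\ a).
      by move: BA; rewrite !powersetE subsetD1 aB andbT.
    rewrite imset_f //=; apply/negP => /imsetP[C CA eC].
    have: \sum_(i in B) f i = \sum_(i in a |: C) f i.
      by rewrite big_setU1 ?(sub1 _ CA)//= -eC addrC subrK.
    by move/(dA _ _ BA (sub2 _ CA)) => E; move: aB; rewrite E setU11.
  have BA' : B :\ a \in powerset (A :\ a).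
    by move: BA; rewrite !powersetE; apply: setSD.
  rewrite (big_setD1 a) //= [f a + _]addrC addrK [X in _ (+) X]imset_f // addbT.
  apply/negP => /imsetP[C CA eC].
  have: \sum_(i in B) f i = \sum_(i in C) f i by rewrite -eC (big_setD1 a) //= addrC.
  move/(dA _ _ BA (sub1 _ CA).1) => E.
  by have := (sub1 _ CA).2; rewrite -E aB.
- case: (boolP (t \in _)) => [/imsetP[B BA ->] _|_ /= /imsetP[B BA eB]].
    by apply/imset_f/(sub1 _ BA).1.
  apply/imsetP; exists (a |: B); first exact: sub2.
  by rewrite big_setU1 ?(sub1 _ BA)//= -eB addrC subrK.
Qed.

Lemma sum_setS (I : finType) (V : finZmodType) (f : I -> V) (A B : {set I}) :
  B \subset A -> sum_set f B \subset sum_set f A.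
Proof. by move=> sBA; apply: imsetS; rewrite powersetS. Qed.

Lemma sum_setD1r (I : finType) (V : finZmodType) (f : I -> V) (A : {set I}) a t :
  a \in A -> t - f a \in sum_set f (A :\ a) -> t \in sum_set f A.
Proof.
move=> aA /imsetP[B]; rewrite powersetE subsetD1 => /andP[BA aB] e.
apply/imsetP; exists (a |: B); first by rewrite powersetE subUset sub1set aA.
by rewrite big_setU1 //= -e addrC subrK.
Qed.

Lemma distinct_sums_neq0 (I : finType) (V : zmodType) (f : I -> V) (A : {set I}) a :
  distinct_sums f A -> a \in A -> f a != 0.
Proof.
move=> dA aA; apply/eqP=> fa0.
have := dA [set a] set0; rewrite !powersetE sub1set aA sub0set big_set1 big_set0.
by move=> /(_ isT isT fa0)/setP/(_ a); rewrite !inE eqxx.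
Qed.

Lemma distinct_sums_opp (I : finType) (V : zmodType) (f : I -> V) (A : {set I}) a b :
  distinct_sums f A -> a \in A -> b \in A -> a != b -> f a + f b != 0.
Proof.
move=> dA aA bA ab; apply/eqP=> fab.
have := dA [set a; b] set0; rewrite !powersetE subUset !sub1set aA bA sub0set big_set0.
rewrite big_setU1 ?inE //= big_set1.
by move=> /(_ isT isT fab)/setP/(_ a); rewrite !inE eqxx.
Qed.

(** * Groups of order [2 ^ m + 1] *)

Lemma mulrn_card (V : finZmodType) (x : V) : x *+ #|V| = 0.
Proof.
by have := expg_cardG (in_setT x); rewrite cardsT FinRing.zmodXgE.
Qed.

Lemma mulrn_mod_card (V : finZmodType) (x : V) k : x *+ (k %% #|V|) = x *+ k.
Proof.
by rewrite [in RHS](divn_eq k #|V|) mulrnDr mulnC mulrnA mulrn_card mul0rn add0r.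
Qed.

Lemma alternating_mem (V : zmodType) (B : pred V) (a t : V) k :
  (forall i, (i < k)%N -> (t + a *+ i.+1 \in B) = (t + a *+ i \notin B)) ->
  (t + a *+ k \in B) = odd k (+) (t \in B).
Proof.
elim: k => [|k IH] H; first by rewrite mulr0n addr0.
rewrite H // IH => [|i ik]; last by apply: H; apply: ltnW.
by rewrite /= addNb.
Qed.

(** Away from [u], the group is partitioned by [B] and [B + a]. On a coset
of the subgroup generated by [a] that avoids [u], membership in [B] alternates
along steps of [a], which is impossible on a cycle of odd length; so every
element lies on the cycle through [u]. *)
Lemma near_tiling_generator (V : finZmodType) (B : {set V}) (a u : V) :
  odd #|V| ->
  (forall t, (t != u) = (t \in B) (+) (t - a \in B)) ->
  forall t, exists2 k, (k < #|V|)%N & t = u + a *+ k.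
Proof.
move=> oV H t; have V0 := odd_gt0 oV.
have [/existsP[i /eqP ei]|] := boolP [exists i : 'I_#|V|.+1, t + a *+ i == u].
  exists ((#|V| - i) %% #|V|)%N; first by rewrite ltn_pmod.
  by rewrite mulrn_mod_card mulrnBr -1?ltnS // mulrn_card sub0r -ei addrK.
rewrite negb_exists => /forallP nk; exfalso.
have := @alternating_mem V (mem B) a t #|V|; rewrite mulrn_card addr0 oV.
suff alt i : (i < #|V|)%N -> (t + a *+ i.+1 \in B) = (t + a *+ i \notin B).
  by move=> /(_ alt); case: (_ \in _).
move=> iV.
have:= H (t + a *+ i.+1); rewrite (nk (Ordinal (_ : (i.+1 < #|V|.+1)%N))) //.
by rewrite [in X in _ (+) X]mulrSr addrA addrK; do 2 case: (_ \in B).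
Qed.

(** Consequently [B] is forced: it consists of every second point of the
path [u, u + a, u + 2a, ...]. *)
Lemma near_tiling_path (V : finZmodType) (B : {set V}) (a u : V) :
  odd #|V| ->
  (forall t, (t != u) = (t \in B) (+) (t - a \in B)) -> u \notin B ->
  forall k, (k < #|V|)%N -> (u + a *+ k \in B) = odd k.
Proof.
move=> oV H uB.
have inj : {in gtn #|V| &, injective (fun k => u + a *+ k)}.
  pose g (k : 'I_#|V|) := u + a *+ k.
  have gs : injective g.
    suff /imset_injP gi : #|g @: setT| == #|[set: 'I_#|V|]|.
      by move=> i j; apply: gi; rewrite inE.
    suff -> : g @: setT = setT by rewrite !cardsT card_ord.
    apply/setP => t; have [k kV ->] := near_tiling_generator oV H t.
    by rewrite inE; apply/imsetP; exists (Ordinal kV).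
  by move=> k l kV lV e; have [] := gs (Ordinal kV) (Ordinal lV) e.
move=> k kV; have := @alternating_mem V (mem B) a u k; rewrite (negPf uB) addbF; apply=> i ik.
have iV := leq_ltn_trans ik kV.
have: u + a *+ i.+1 != u.
  apply/eqP=> e; have := inj i.+1 0%N iV (odd_gt0 oV).
  by rewrite mulr0n addr0 e => /(_ erefl).
by rewrite H [in X in _ (+) X]mulrSr addrA addrK /=; do 2 case: (_ \in B).
Qed.

(** The conditions say that [F] and [F + c] tile the interval [0, L). Read
from the left end, [F] must be made of alternate blocks of length [c]; the right
end then forces the last block to be complete and outside [F]. *)
Lemma interval_tiling (F : pred nat) (c L : nat) : (0 < c <= L)%N ->
  (forall k, (k < c)%N -> F k) ->
  (forall k, (k + c < L)%N -> F (k + c)%N = ~~ F k) ->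
  (forall k, (k < L)%N -> F k -> (k + c < L)%N) ->
  ((c %| L) && (c < L))%N.
Proof.
move=> /andP[c0 cL] F0 FS FL.
have Fq k : (k < L)%N -> F k = ~~ odd (k %/ c).
  elim/ltn_ind: k => k IH kL; have [kc|ck] := ltnP k c.
    by rewrite F0 // divn_small.
  have e : (k = (k - c) + c)%N by rewrite subnK.
  have -> : (k %/ c = (k - c) %/ c + 1)%N by rewrite {1}e divnDr ?dvdnn // divnn c0.
  have -> : F k = ~~ F (k - c)%N by rewrite {1}e FS // -e.
  rewrite IH; [by rewrite addn1|lia|lia].
have Lc : (c < L)%N by have := FL 0%N (leq_trans c0 cL) (F0 _ c0).
rewrite Lc andbT.
have end_odd k : (L - c <= k < L)%N -> odd (k %/ c).
  move=> /andP[k1 k2]; have := FL k k2; rewrite Fq //; case: odd => // /(_ isT); lia.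
(* The last [c] integers are not in [F], so both of their extreme block
   numbers are odd; if [c] did not divide [L] these would be consecutive. *)
have o1 := end_odd (L - c)%N ltac:(lia); have o2 := end_odd (L - 1)%N ltac:(lia).
have eL := divn_eq L c.
have rc := ltn_pmod L c0.
have [/eqP r0|r0] := posnP (L %% c); first by rewrite /dvdn r0.
have q0 : (0 < L %/ c)%N by rewrite divn_gt0.
have e1 : ((L - c) %/ c = (L %/ c).-1)%N.
  by rewrite -{1}[c]mul1n divnBMl subn1.
have e2 : ((L - 1) %/ c = L %/ c)%N.
  rewrite {1}eL -addnBA // divnMDl // [((L %% c - 1) %/ c)%N]divn_small ?addn0 //; lia.
by move: o1; rewrite e1 -e2; move: o2; rewrite e2; case: (L %/ c)%N q0 => //= q _ /negPf->.
Qed.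

(** The odd-indexed points of the path [u + a *+ k] form an arithmetic
progression of length [L] in a cycle of length [2L + 1]. A translate by [c] of
its steps that stays inside it cannot wrap around, because doing so would land on
an even index; so a tiling of the progression is a tiling of an interval. *)
Lemma path_tiling (V : finZmodType) (B D : {set V}) (a u : V) (c L : nat) :
  #|V| = L.*2.+1 -> (0 < c <= L)%N ->
  (forall k, (k < #|V|)%N -> (u + a *+ k \in B) = odd k) ->
  D \subset B ->
  (forall t, t \in D -> t + a *+ c.*2 \in B) ->
  (forall t, t \in B -> (t \in D) = (t - a *+ c.*2 \notin D)) ->
  ((c %| L) && (c < L))%N.
Proof.
move=> cV cL HB /subsetP DB DcB HD.
have wrap k : u + a *+ (k + #|V|) = u + a *+ k by rewrite mulrnDr mulrn_card addr0.
have odd_idx k : (k < L)%N -> u + a *+ k.*2.+1 \in B.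
  by move=> kL; rewrite HB ?cV /= ?odd_double //; lia.
apply: (@interval_tiling (fun k => u + a *+ k.*2.+1 \in D)) => // k.
- move=> kc; rewrite HD; last by apply: odd_idx; lia.
  apply: contraTN isT => /DB.
  (* Stepping back past the start of the progression lands on an even index. *)
  have -> : u + a *+ k.*2.+1 - a *+ c.*2 = u + a *+ (L.+1 + k - c).*2.
    apply/eqP; rewrite subr_eq -addrA -mulrnDr.
    have -> : ((L.+1 + k - c).*2 + c.*2 = k.*2.+1 + #|V|)%N by rewrite cV; lia.
    by rewrite wrap.
  rewrite HB ?odd_double // cV; lia.
- move=> kcL; rewrite HD; last exact: odd_idx.
  by rewrite doubleD -addSn mulrnDr [u + (_ + _)]addrA addrK.
- move=> kL /DcB; rewrite -addrA -mulrnDr => kB.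
  rewrite ltnNge; apply/negP=> Lk; move: kB.
  have -> : (k.*2.+1 + c.*2 = (k + c - L).*2 + #|V|)%N by rewrite cV; lia.
  rewrite wrap HB ?odd_double // cV; lia.
Qed.

(** With [m] elements in a group of order [2 ^ m + 1] exactly one element
[u] is not a subset sum. Splitting off [a] shows that the remaining sums are every
second point of a path with step [a]; splitting off [b] as well shows that this
progression is tiled by two translates of one set, so the translation is by a
divisor of its length [2 ^ (m - 1)]. *)
Lemma power_of_two_structure (I : finType) (V : finZmodType) (f : I -> V)
    (A : {set I}) (m : nat) a b :
  #|V| = (2 ^ m).+1 -> #|A| = m -> distinct_sums f A -> a \in A -> b \in A ->
  exists2 i, (i < m)%N & f b = f a *+ 2 ^ i \/ f b = - (f a *+ 2 ^ i).
Proof.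
move=> cV cA dA aA bA.
have m0 : (0 < m)%N by rewrite -cA; apply/card_gt0P; exists a.
have [->|ba] := eqVneq b a; first by exists 0%N => //; left.
have eL : (2 ^ m = (2 ^ m.-1).*2)%N by rewrite -mul2n -expnS prednK.
have oV : odd #|V| by rewrite cV eL /= odd_double.
have [u eu] : exists u, ~: sum_set f A = [set u].
  apply/cards1P; have := cardsC (sum_set f A).
  rewrite card_sum_set // cA cV; lia.
have uA t : (t != u) = (t \in sum_set f A).
  by rewrite -in_set1 -eu inE negbK.
set B := sum_set f (A :\ a).
have HB t : (t != u) = (t \in B) (+) (t - f a \in B) by rewrite uA (sum_setD1 _ aA).
have uB : u \notin B.
  by apply/negP=> /(subsetP (sum_setS f (subD1set A a))); rewrite -uA eqxx.
have Bodd := near_tiling_path oV HB uB.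
have bA' : b \in A :\ a by rewrite !inE ba.
have dA' : distinct_sums f (A :\ a) by apply: distinct_sumsS dA; apply: subD1set.
have [k kV fbk] : exists2 k, (k < #|V|)%N & f b = f a *+ k.
  by have [k kV /addrI e] := near_tiling_generator oV HB (u + f b); exists k.
have k0 : (0 < k)%N.
  by case: k fbk {kV} => // /eqP; rewrite (negPf (distinct_sums_neq0 dA bA)).
set C := sum_set f (A :\ a :\ b).
have HC t := sum_setD1 t bA' dA'; rewrite -/C -/B in HC.
have sCB : C \subset B by apply/sum_setS/subD1set.
have CB t : t - f b \in C -> t \in B by apply: sum_setD1r.
suff [c [c0 cE fbE]] : exists c, [/\ (0 < c)%N, ((c %| 2 ^ m.-1) && (c < 2 ^ m.-1))%N &
    f b = f a *+ c.*2 \/ f b = - (f a *+ c.*2)].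
  case/andP: cE c0 fbE => /(@dvdn_pfactor 2 c m.-1 isT)[i _ ->].
  rewrite ltn_exp2l // => im _ fbE; exists i.+1; first lia.
  by rewrite expnS mul2n.
(* The group has odd order, so exactly one of [f b] and [- f b] is an even
   multiple of [f a] with multiplier below [#|V|]. In the second case the tile
   is [C + f b] instead of [C]. *)
exists (if odd k then (#|V| - k)./2 else k./2).
have [ok|ek] := boolP (odd k).
  have e : ((#|V| - k)./2.*2 = #|V| - k)%N by rewrite even_halfK // oddB ?ok ?oV // ltnW.
  have fbE : f b = - (f a *+ (#|V| - k)./2.*2).
    by rewrite e mulrnBr ?mulrn_card ?sub0r ?opprK // ltnW.
  have c0 : (0 < (#|V| - k)./2)%N by lia.
  split=> //; last by right.
  apply: (@path_tiling V B [set t | t - f b \in C] (f a) u) => //.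
  - by rewrite cV eL.
  - lia.
  - by apply/subsetP=> t; rewrite inE; apply: CB.
  - move=> t; rewrite inE => tC; apply: (subsetP sCB).
    by rewrite -[f a *+ _]opprK -fbE.
  - move=> t; rewrite !inE HC -[in X in _ - X - _](opprK (f a *+ _)) -fbE opprK addrK.
    by do 2 case: (_ \in C).
have e : (k./2.*2 = k)%N by rewrite even_halfK.
split; [lia| |left; by rewrite e].
apply: (@path_tiling V B C (f a) u) => //; rewrite ?e -?fbk.
- by rewrite cV eL.
- lia.
- by move=> t tC; apply: CB; rewrite addrK.
- by move=> t; rewrite HC; do 2 case: (_ \in C).
Qed.

(** * The generating polynomial *)

Lemma prod1D_powerset (R : comNzRingType) (I : finType) (x : I -> R) (A : {set I}) :
  \prod_(i in A) (1 + x i) = \sum_(B in powerset A) \prod_(i in B) x i.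
Proof.
transitivity (\prod_i ((if i \in A then x i else 0) + 1)).
  by rewrite big_mkcond; apply: eq_bigr => i _; case: ifP => _; rewrite ?add0r // addrC.
rewrite bigA_distr [RHS]big_mkcond; apply: eq_bigr => B _; rewrite -big_mkcond powersetE.
case: ifP => [/subsetP sBA|/negbT/subsetPn[i iB iA]].
  by apply: eq_bigr => i /sBA ->.
by rewrite (bigD1 i) //= (negPf iA) mul0r.
Qed.

Lemma Zp_val_sum (N : nat) (B : {set 'Z_N}) : (1 < N)%N ->
  \sum_(a in B) a = ((\sum_(a in B) (a : nat)) %% N)%N :> nat.
Proof.
move=> N1; rewrite -val_Zp_nat // natr_sum; congr val.
by apply: eq_bigr => a _; rewrite natr_Zp.
Qed.

Lemma Zp_lt (N : nat) (a : 'Z_N) : (1 < N)%N -> (a < N)%N.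
Proof. by move=> N1; have := ltn_ord a; rewrite [X in (_ < X)%N]Zp_cast. Qed.

Lemma dvdp_exp_mod (F : fieldType) (N k : nat) :
  ('X^N - 1 : {poly F}) %| 'X^k - 'X^(k %% N).
Proof.
have -> : 'X^k - 'X^(k %% N) = 'X^(k %% N) * (('X^N) ^+ (k %/ N) - 1) :> {poly F}.
  by rewrite mulrBr mulr1 -exprM -exprD addnC mulnC -divn_eq.
by apply: dvdp_mull; rewrite [X in _ %| X]subrX1; apply: dvdp_mulr.
Qed.

(** Expanding the product gives one monomial for each subset; modulo
['X^N - 1] its exponent is the corresponding sum in ['Z_N], and only [u] and [v]
are missing. The factor ['X - 1] turns the sum of all powers into ['X^N - 1].
Stating this over an arbitrary field serves both complex roots of unity and
polynomials over ['F_p]. *)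
Lemma generating_polynomial (F : fieldType) (N : nat) (A : {set 'Z_N}) (u v : 'Z_N) :
  (1 < N)%N -> distinct_sums id A -> u != v -> ~: sum_set id A = [set u; v] ->
  ('X^N - 1 : {poly F}) %| ('X - 1) * (\prod_(a in A) (1 + 'X^a) + 'X^u + 'X^v).
Proof.
move=> N1 dA uv eS.
have allE : \sum_(t : 'Z_N) 'X^t = \sum_(t in sum_set id A) 'X^t + 'X^u + 'X^v :> {poly F}.
  rewrite (bigID (mem (sum_set id A))) /= -addrA; congr (_ + _).
  rewrite (eq_bigl (mem [set u; v])); last by move=> t; rewrite -eS !inE.
  by rewrite big_setU1 ?inE //= big_set1.
have cong : ('X^N - 1 : {poly F}) %|
    \prod_(a in A) (1 + 'X^a) - \sum_(t in sum_set id A) 'X^t.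
  rewrite prod1D_powerset big_imset //= -sumrB.
  apply: (big_ind (fun p => 'X^N - 1 %| p)); [exact: dvdp0|exact: dvdp_add|].
  by move=> B _; rewrite prodrXr Zp_val_sum // dvdp_exp_mod.
have geom : ('X - 1) * (\sum_(t : 'Z_N) 'X^t) = 'X^N - 1 :> {poly F}.
  by rewrite -(subrX1 _ (Zp_trunc N).+2) Zp_cast.
have -> : ('X - 1) * (\prod_(a in A) (1 + 'X^a) + 'X^u + 'X^v) =
   ('X - 1) * (\prod_(a in A) (1 + 'X^a) - \sum_(t in sum_set id A) 'X^t) + ('X^N - 1)
   :> {poly F}.
  by rewrite -geom allE; ring.
by rewrite dvdp_add // dvdp_mull.
Qed.

Lemma root_of_unity_identity (F : fieldType) (N : nat) (A : {set 'Z_N}) (u v : 'Z_N) (w : F) :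
  (1 < N)%N -> distinct_sums id A -> u != v -> ~: sum_set id A = [set u; v] ->
  w ^+ N = 1 -> w != 1 ->
  \prod_(a in A) (1 + w ^+ a) = - (w ^+ u + w ^+ v).
Proof.
move=> N1 dA uv eS wN w1.
have /dvdpP[q /(congr1 (horner^~ w))] := generating_polynomial F N1 dA uv eS.
rewrite !hornerE horner_prod wN subrr mulr0 => /eqP.
rewrite mulf_eq0 subr_eq0 (negPf w1) /= -addrA addr_eq0 => /eqP <-.
by apply: eq_bigr => a _; rewrite !hornerE.
Qed.

(** Evaluate at [-1]. Without an odd member the product would be
[2 ^ #|A| >= 4], too large to be a sum of two signs; with one it vanishes, and
the two signs must cancel. *)
Lemma missing_parity (N : nat) (A : {set 'Z_N}) (u v : 'Z_N) :
  (1 < N)%N -> ~~ odd N -> (1 < #|A|)%N ->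
  distinct_sums id A -> u != v -> ~: sum_set id A = [set u; v] ->
  (exists2 a : 'Z_N, a \in A & odd a) /\ odd u != odd v.
Proof.
move=> N1 eN A2 dA uv eS.
have := @root_of_unity_identity rat N A u v (-1) N1 dA uv eS.
rewrite -signr_odd (negPf eN) expr0 => /(_ erefl isT).
have [/exists_inP[a aA oa]|] := boolP [exists a in A, odd (a : 'Z_N)].
  rewrite (bigD1 a) //= -signr_odd oa expr1 subrr mul0r => /eqP.
  rewrite eq_sym oppr_eq0 -(signr_odd _ u) -(signr_odd _ v) => e.
  by split; [exists a|move: e; do 2 case: odd].
rewrite negb_exists_in => /forall_inP nA.
rewrite (eq_bigr (fun=> 2%:R)); last first.
  by move=> a /nA ea; rewrite -signr_odd (negPf ea).
rewrite prodr_const -(signr_odd _ u) -(signr_odd _ v).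
have : (4 <= 2 ^+ #|A| :> rat) by rewrite -natrX ler_nat (@leq_exp2l 2 2).
by do 2 case: odd; rewrite ?expr0 ?expr1; lra.
Qed.

(** Let [g] be the gcd of [v - u] and [M], and [w] a root of unity of order
[2g]. As [v - u] is an odd multiple of [g], [w ^ u + w ^ v] vanishes, hence so does
some factor [1 + w ^ a]. *)
Lemma odd_multiple_member (M N : nat) (A : {set 'Z_N}) (u v : 'Z_N) :
  odd M -> N = M.*2 -> (1 < N)%N ->
  distinct_sums id A -> (u < v)%N -> ~: sum_set id A = [set u; v] -> odd (v - u) ->
  exists a : 'Z_N, [/\ a \in A, odd a & (gcdn (v - u) M %| a)%N].
Proof.
move=> oM NM N1 dA uv eS od.
have M0 := odd_gt0 oM.
set g := gcdn _ _; have gM : (g %| M)%N by apply: dvdn_gcdr.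
have gd : (g %| v - u)%N by apply: dvdn_gcdl.
have og : odd g by apply: dvdn_odd gM oM.
have g0 := odd_gt0 og.
have g20 : (0 < g.*2)%N by rewrite double_gt0.
have [w pw] := C_prim_root_exists g20.
have wodd k : odd k -> (g %| k)%N -> w ^+ k = -1.
  move=> ok gk; have : w ^+ k != 1.
    rewrite -(prim_order_dvd pw); apply: contraL ok => gk2.
    by rewrite -dvdn2; apply: dvdn_trans gk2; rewrite -muln2 dvdn_mull.
  have : (w ^+ k) ^+ 2 == 1.
    by rewrite -exprM -(prim_order_dvd pw) muln2 -!muln2 dvdn_pmul2r.
  by rewrite sqrf_eq1 => /orP[->//|/eqP].
have := @root_of_unity_identity algC N A u v w N1 dA _ eS.
have -> : w ^+ v = w ^+ u * w ^+ (v - u) by rewrite -exprD subnKC // ltnW.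
rewrite (wodd _ od gd) mulrN1 subrr oppr0.
move=> H; have /eqP : \prod_(a in A) (1 + w ^+ a) = 0.
  apply: H.
  - by apply: contraTneq uv => ->; rewrite ltnn.
  - by apply/eqP; rewrite -(prim_order_dvd pw) NM -!muln2 dvdn_pmul2r.
  - rewrite -[w]expr1 -(prim_order_dvd pw) dvdn1; lia.
rewrite prodf_seq_eq0 => /hasP[a _ /andP[aA]]; rewrite addrC addr_eq0 => /eqP wa.
have na : ~~ (g.*2 %| a)%N by rewrite (prim_order_dvd pw) wa eqNr oner_eq0.
have ga : (g %| a)%N.
  rewrite -(@dvdn_pmul2r 2) // !muln2 (prim_order_dvd pw) -muln2 exprM wa.
  by rewrite sqrrN expr1n.
exists a; split=> //; apply: contraR na => ea.
by rewrite -muln2 Gauss_dvd ?coprimen2 // ga dvdn2.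
Qed.

(** * Multiplicities over [F_p] *)

Lemma expr1D_pchar (p j : nat) (f : {poly 'F_p}) : prime p ->
  (1 + f) ^+ (p ^ j) = 1 + f ^+ (p ^ j).
Proof.
move=> pp; rewrite exprDn_pchar ?expr1n //.
have pc : p \in [pchar {poly 'F_p}] by rewrite pchar_poly; apply: pchar_Fp.
by rewrite (eq_pnat _ (pcharf_eq pc)) pnatX pnat_id.
Qed.

Lemma root_1DXn (F : fieldType) (b : nat) : odd b -> root (1 + 'X^b : {poly F}) (-1).
Proof. by move=> ob; rewrite /root !hornerE -signr_odd ob subrr. Qed.

Lemma dvdp_pfactor_1DXn (p j a : nat) : prime p -> odd a -> (p ^ j %| a)%N ->
  ('X - (-1)%:P) ^+ (p ^ j) %| (1 + 'X^a : {poly 'F_p}).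
Proof.
move=> pp oa /dvdnP[b eb]; rewrite eb exprM -expr1D_pchar //.
apply: dvdp_exp2r; rewrite dvdp_XsubCl root_1DXn //.
by move: oa; rewrite eb oddM => /andP[].
Qed.

(** If [a = b p^j] then [1 + 'X^a] is the [p^j]-th power of [1 + 'X^b],
which has [-1] as a simple root since its derivative there is [b], nonzero
modulo [p]. *)
Lemma Ndvdp_pfactor_1DXn (p j a : nat) : prime p -> odd a ->
  (p ^ j %| a)%N -> ~~ (p ^ j.+1 %| a)%N ->
  ~~ (('X - (-1)%:P) ^+ (p ^ j).+1 %| (1 + 'X^a : {poly 'F_p})).
Proof.
move=> pp oa /dvdnP[b eb]; rewrite eb expnS dvdn_pmul2r ?expn_gt0 ?prime_gt0 // => pb.
have ob : odd b by move: oa; rewrite eb oddM => /andP[].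
have /factor_theorem[C eC] := root_1DXn 'F_p ob.
rewrite exprM -expr1D_pchar // eC exprMn exprS dvdp_mul2r; last first.
  by rewrite expf_neq0 // polyXsubC_eq0.
rewrite dvdp_XsubCl rootE horner_exp expf_eq0 negb_and; apply/orP; right.
have := congr1 (fun q => q^`().[-1]) eC.
rewrite !derivE !hornerE hornerMn hornerXn -signr_odd subrr mulr0 add0r => <-.
have -> : odd b.-1 = false by lia.
rewrite expr0 -(dvdn_pcharf (pchar_Fp pp)) //.
Qed.

(** Compare multiplicities of the root [-1] over ['F_p]. Below [p^(j+1)],
the multiplicity of ['X^N - 1], that of the product equals that of
[1 + 'X^(v - u)], namely [p^j]. The factor of [a] already contributes [p^j], and any
other odd member would contribute at least one more. *)
Lemma odd_member_unique (p j M N : nat) (A : {set 'Z_N}) (u v a b : 'Z_N) :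
  odd M -> N = M.*2 -> (1 < N)%N ->
  distinct_sums id A -> (u < v)%N -> ~: sum_set id A = [set u; v] -> odd (v - u) ->
  prime p -> (p ^ j.+1 %| M)%N -> (p ^ j %| v - u)%N -> ~~ (p ^ j.+1 %| v - u)%N ->
  a \in A -> odd a -> (p ^ j %| a)%N -> b \in A -> odd b -> b = a.
Proof.
move=> oM NM N1 dA uv eS od pp pM pd pNd aA oa pa bA ob; apply/eqP/negPn/negP => ba.
have p0 := prime_gt0 pp.
have op : odd p by apply: dvdn_odd oM; apply: dvdn_trans pM; rewrite expnS dvdn_mulr.
pose Z : {poly 'F_p} := 'X - (-1)%:P.
have neuv : u != v by apply: contraTneq uv => ->; rewrite ltnn.
have := generating_polynomial 'F_p N1 dA neuv eS.
set P := \prod_(c in A) _; set Q := 'X^N - 1 => QP.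
have ZQ : Z ^+ (p ^ j.+1) %| Q.
  have [m em] := dvdnP pM.
  have -> : Q = ('X^(m.*2) - 1) ^+ (p ^ j.+1).
    have oq : odd (p ^ j.+1) by rewrite oddX op orbT.
    have neg (f : {poly 'F_p}) : (- f) ^+ (p ^ j.+1) = - f ^+ (p ^ j.+1).
      by rewrite exprNn -signr_odd oq expr1 mulN1r.
    rewrite -opprB neg expr1D_pchar // neg opprB -exprM.
    by rewrite /Q NM em doubleMl.
  apply: dvdp_exp2r; rewrite dvdp_XsubCl /root !hornerE -signr_odd odd_double.
  by rewrite expr0 subrr.
have Zne c (x : {poly 'F_p}) : x.[-1] != 0 -> coprimep (Z ^+ c) x.
  by move=> x0; apply: coprimep_expl; rewrite coprimep_sym coprimep_XsubC.
have two0 : (2%:R : 'F_p) != 0.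
  rewrite -(dvdn_pcharf (pchar_Fp pp)) dvdn_prime2 //; apply: contraTneq op => ->. by [].
have ZP : Z ^+ (p ^ j.+1) %| P + 'X^u + 'X^v.
  have := dvdp_trans ZQ QP; rewrite Gauss_dvdpr //; apply: Zne; rewrite !hornerE.
  by rewrite -opprD oppr_eq0.
have le_pj : ((p ^ j).+1 <= p ^ j.+1)%N by rewrite ltn_exp2l // prime_gt1.
have ZPab : Z ^+ (p ^ j).+1 %| P.
  rewrite /P (bigD1 a) //= (bigD1 b) ?bA ?ba //= mulrA dvdp_mulr // exprSr dvdp_mul //.
    exact: dvdp_pfactor_1DXn.
  by rewrite dvdp_XsubCl root_1DXn.
have := dvdp_trans (dvdp_exp2l Z le_pj) ZP.
rewrite -addrA dvdp_addr //.
have -> : 'X^v = 'X^u * 'X^(v - u) :> {poly 'F_p} by rewrite -exprD subnKC // ltnW.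
rewrite -{1}['X^u]mulr1 -mulrDr Gauss_dvdpr; last first.
  by apply: Zne; rewrite !hornerE expf_neq0 // oppr_eq0 oner_eq0.
by apply/negP; apply: Ndvdp_pfactor_1DXn.
Qed.

(** * The dichotomy *)

Definition half_mod (M N : nat) : 'Z_N := M%:R.

Lemma val_half_mod (M N : nat) : (1 < M)%N -> N = M.*2 -> half_mod M N = M :> nat.
Proof. by move=> M1 NM; rewrite val_Zp_nat ?modn_small; lia. Qed.

(** The gcd [g] of [v - u] and [M] divides some odd member [a]. If [g = M]
then [a] is [M] itself; otherwise [odd_member_unique] applies to a prime divisor of
[M / g]. *)
Lemma dichotomy (M N : nat) (A : {set 'Z_N}) :
  odd M -> (1 < M)%N -> N = M.*2 -> (2 ^ #|A| + 2 = N)%N -> (1 < #|A|)%N ->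
  distinct_sums id A ->
  (exists2 a : 'Z_N, (a \in A) && odd a & forall b : 'Z_N, b \in A -> odd b -> b = a)
  \/ half_mod M N \in A.
Proof.
move=> oM M1 NM cA A2 dA.
have N1 : (1 < N)%N by lia.
have eN : ~~ odd N by rewrite NM odd_double.
have [u [v [uv eS]]] : exists u v : 'Z_N, u != v /\ ~: sum_set id A = [set u; v].
  have /cards2P[u [v [uv eS]]] : #|~: sum_set id A| == 2%N; last by exists u, v.
  have := cardsC (sum_set id A); rewrite card_sum_set // card_ord Zp_cast // => e.
  by apply/eqP; apply: addnI (etrans e (esym cA)).
wlog ltuv : u v uv eS / (u < v)%N.
  move=> wl; have [uv'|vu|/val_inj e] := ltngtP u v; first exact: (wl u v).
    by apply: (wl v u) => //; [rewrite eq_sym|rewrite setUC].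
  by rewrite e eqxx in uv.
have [_ puv] := missing_parity N1 eN A2 dA uv eS.
have od : odd (v - u) by rewrite oddB 1?ltnW //; move: puv; do 2 case: odd.
have [a [aA oa ga]] := odd_multiple_member oM NM N1 dA ltuv eS od.
set g := gcdn _ _ in ga; have gM : (g %| M)%N by apply: dvdn_gcdr.
have g0 : (0 < g)%N by rewrite gcdn_gt0 odd_gt0 // orbT.
have [geM|gneM] := eqVneq g M.
  right; suff -> : half_mod M N = a by [].
  apply: val_inj; rewrite /= val_half_mod //.
  have /dvdnP[k ek] := ga; have := Zp_lt a N1; rewrite ek geM NM.
  move: oa; rewrite ek geM -[M.*2]mul2n ltn_pmul2r; last exact: ltnW.
  by case: k {ek} => [|[|k]] //; rewrite mul1n.
left; exists a; first by rewrite aA oa.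
have [q eq] := dvdnP gM.
have q1 : (1 < q)%N.
  by case: q eq => [|[|q]] // e; [rewrite e in M1|rewrite e mul1n eqxx in gneM].
have pp := pdiv_prime q1; set p := pdiv q in pp.
have pg : (p ^ (logn p g) %| g)%N by apply: pfactor_dvdnn.
move=> b bA ob; apply: (@odd_member_unique p (logn p g) M N A u v a b) => //.
- by rewrite eq expnS dvdn_mul // pdiv_dvd.
- by apply: dvdn_trans pg (dvdn_gcdl _ _).
- apply/negP=> pd; suff: (p ^ (logn p g).+1 %| g)%N by rewrite pfactor_dvdn // ltnn.
  by rewrite dvdn_gcd pd eq expnS dvdn_mul // pdiv_dvd.
- exact: dvdn_trans pg ga.
Qed.

(** * Reduction modulo [N / 2] *)

Definition reduce (M N : nat) (x : 'Z_N) : 'Z_M := (x : nat)%:R.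
Arguments reduce M {N} x.

Lemma eqZp_nat (M x y : nat) : (1 < M)%N ->
  (x%:R = y%:R :> 'Z_M) <-> (x = y %[mod M])%N.
Proof.
move=> M1; split=> [/(congr1 val)|e]; first by rewrite /= !val_Zp_nat.
by apply: val_inj; rewrite /= !val_Zp_nat.
Qed.

Lemma natr_mod_Zp (M N k : nat) : (1 < M)%N -> (M %| N)%N -> (k %% N)%:R = k%:R :> 'Z_M.
Proof. by move=> M1 MN; apply/eqZp_nat; rewrite // modn_dvdm. Qed.

Lemma reduce_sum (M N : nat) (B : {set 'Z_N}) : (1 < M)%N -> (1 < N)%N -> (M %| N)%N ->
  reduce M (\sum_(x in B) x) = \sum_(x in B) reduce M x.
Proof. by move=> M1 N1 MN; rewrite /reduce Zp_val_sum // natr_mod_Zp // natr_sum. Qed.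

Lemma reduceD (M N : nat) (x y : 'Z_N) : (1 < M)%N -> (1 < N)%N -> (M %| N)%N ->
  reduce M (x + y) = reduce M x + reduce M y.
Proof.
move=> M1 N1 MN; rewrite /reduce -natrD -(natr_mod_Zp (_ + _) M1 MN) -val_Zp_nat //.
by rewrite natrD !natr_Zp.
Qed.

Lemma oddD_Zp (N : nat) (x y : 'Z_N) : (1 < N)%N -> ~~ odd N ->
  odd (x + y)%R = odd x (+) odd y.
Proof.
move=> N1 eN; rewrite -oddD -{1}(natr_Zp x) -{1}(natr_Zp y) -natrD val_Zp_nat //.
by rewrite odd_mod // (negPf eN).
Qed.

Lemma even_sum_Zp (N : nat) (B : {set 'Z_N}) : (1 < N)%N -> ~~ odd N ->
  (forall b : 'Z_N, b \in B -> ~~ odd b) -> ~~ odd (\sum_(b in B) b)%R.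
Proof.
move=> N1 eN; apply: (big_ind (fun x : 'Z_N => ~~ odd x)) => //.
by move=> x y; rewrite oddD_Zp // => /negPf-> /negPf->.
Qed.

(** Chinese remainder theorem for [N = 2 * M] with [M] odd. *)
Lemma reduce_parity_inj (M N : nat) (x y : 'Z_N) :
  odd M -> (1 < M)%N -> N = M.*2 -> reduce M x = reduce M y -> odd x = odd y -> x = y.
Proof.
move=> oM M1 NM /(eqZp_nat _ _ M1) exy oxy; apply: val_inj => /=.
have N1 : (1 < N)%N by lia.
rewrite -(modn_small (Zp_lt x N1)) -(modn_small (Zp_lt y N1)) [X in (_ %% X)%N]NM.
rewrite [X in _ = (_ %% X)%N]NM -muln2; apply/eqP.
by rewrite chinese_remainder ?coprimen2 // exy eqxx !modn2 oxy eqxx.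
Qed.

Lemma reduce_half_mod (M N : nat) : (1 < M)%N -> N = M.*2 -> reduce M (half_mod M N) = 0.
Proof. by move=> M1 NM; rewrite /reduce val_half_mod // pchar_Zp. Qed.

Lemma half_mod_neq0 (M N : nat) : (1 < M)%N -> N = M.*2 -> half_mod M N != 0.
Proof.
move=> M1 NM; apply/eqP => /(congr1 val)/=; rewrite val_half_mod //; lia.
Qed.

Lemma sum_setD1_if (I : finType) (V : zmodType) (f : I -> V) (B : {set I}) a :
  \sum_(i in B) f i = (if a \in B then f a else 0) + \sum_(i in B :\ a) f i.
Proof.
case: ifP => [aB|/negbT aB]; first exact: big_setD1.
by rewrite add0r; apply: eq_bigl => i; rewrite !inE; case: eqP => // ->; apply/negbTE.
Qed.

Lemma setD1_inj (I : finType) (B C : {set I}) a :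
  (a \in B) = (a \in C) -> B :\ a = C :\ a -> B = C.
Proof.
move=> e1 /setP e2; apply/setP => x; have := e2 x; rewrite !inE.
by have [->|] := eqVneq x a.
Qed.

(** All sums involved are even, so they are determined by their residues
modulo [M]. *)
Lemma distinct_sums_rest_odd (M N : nat) (A : {set 'Z_N}) (a : 'Z_N) :
  odd M -> (1 < M)%N -> N = M.*2 ->
  (forall b : 'Z_N, b \in A :\ a -> ~~ odd b) ->
  distinct_sums id A -> distinct_sums (reduce M) (A :\ a).
Proof.
move=> oM M1 NM eA dA B C; rewrite !powersetE => BA CA.
have N1 : (1 < N)%N by lia.
have MN : (M %| N)%N by rewrite NM -muln2 dvdn_mulr.
have eN : ~~ odd N by rewrite NM odd_double.
have ev (D : {set 'Z_N}) : D \subset A :\ a -> odd (\sum_(b in D) b)%R = false.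
  by move=> /subsetP DA; apply/negbTE/even_sum_Zp => // b /DA; apply: eA.
rewrite -!reduce_sum // => /reduce_parity_inj-/(_ oM M1 NM); rewrite !ev // => /(_ erefl).
by apply: (distinct_sumsS (subD1set A a) dA); rewrite powersetE.
Qed.

(** Two sums that agree modulo [M] agree or differ by [M]; the difference is
absorbed by adding [M] to one of the subsets. *)
Lemma distinct_sums_rest_half (M N : nat) (A : {set 'Z_N}) :
  odd M -> (1 < M)%N -> N = M.*2 ->
  half_mod M N \in A -> distinct_sums id A ->
  distinct_sums (reduce M) (A :\ half_mod M N).
Proof.
set h := half_mod M N; move=> oM M1 NM hA dA B C; rewrite !powersetE => BA CA.
have N1 : (1 < N)%N by lia.
have MN : (M %| N)%N by rewrite NM -muln2 dvdn_mulr.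
have eN : ~~ odd N by rewrite NM odd_double.
rewrite -!reduce_sum // => e.
move: (BA) (CA); rewrite !subsetD1 => /andP[BA' hB] /andP[CA' hC].
have [par|npar] := eqVneq (odd (\sum_(b in B) b)%R) (odd (\sum_(c in C) c)%R).
  by apply: dA; rewrite ?powersetE //; apply: reduce_parity_inj e par.
have : \sum_(b in B) b = \sum_(c in h |: C) c.
  rewrite big_setU1 //=; apply: (reduce_parity_inj oM M1 NM).
    by rewrite reduceD // reduce_half_mod // add0r.
  by rewrite oddD_Zp // val_half_mod // oM; move: npar; do 2 case: odd.
move/(dA _ _); rewrite !powersetE BA' subUset sub1set hA CA' => /(_ isT isT) E.
by rewrite E setU11 in hB.
Qed.

(** The parity of a subset sum tells whether [a] was used. *)
Lemma distinct_sums_add_odd (M N : nat) (A : {set 'Z_N}) (a : 'Z_N) :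
  odd M -> (1 < M)%N -> N = M.*2 -> odd a ->
  (forall b : 'Z_N, b \in A :\ a -> ~~ odd b) ->
  distinct_sums (reduce M) (A :\ a) -> distinct_sums id A.
Proof.
move=> oM M1 NM oa eA dA B C; rewrite !powersetE => BA CA.
have N1 : (1 < N)%N by lia.
have MN : (M %| N)%N by rewrite NM -muln2 dvdn_mulr.
have eN : ~~ odd N by rewrite NM odd_double.
have par (D : {set 'Z_N}) : D \subset A -> odd (\sum_(b in D) b)%R = (a \in D).
  move=> DA; rewrite (sum_setD1_if id _ a) oddD_Zp //.
  have /negPf-> : ~~ odd (\sum_(b in D :\ a) b)%R.
    by apply: even_sum_Zp => // b /(subsetP (setSD [set a] DA)); apply: eA.
  by case: ifP => _; rewrite ?oa.
move=> e; have aBC : (a \in B) = (a \in C) by rewrite -!par // e.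
apply: (setD1_inj aBC); apply: dA; rewrite ?powersetE ?setSD //.
rewrite -!reduce_sum //; congr reduce; move: e.
by rewrite (sum_setD1_if id _ a) (sum_setD1_if id C a) aBC => /addrI.
Qed.

Lemma distinct_sums_add_half (M N : nat) (A : {set 'Z_N}) :
  (1 < M)%N -> N = M.*2 ->
  distinct_sums (reduce M) (A :\ half_mod M N) -> distinct_sums id A.
Proof.
set h := half_mod M N; move=> M1 NM dA B C; rewrite !powersetE => BA CA e.
have N1 : (1 < N)%N by lia.
have MN : (M %| N)%N by rewrite NM -muln2 dvdn_mulr.
have red (D : {set 'Z_N}) :
    reduce M (\sum_(b in D) b) = \sum_(b in D :\ h) reduce M b.
  rewrite reduce_sum // (sum_setD1_if _ _ h); case: ifP => _; rewrite ?add0r //.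
  by rewrite reduce_half_mod // add0r.
have eD : B :\ h = C :\ h.
  by apply: dA; rewrite ?powersetE ?setSD // -!red e.
apply: setD1_inj (eD); move: e; rewrite (sum_setD1_if id _ h) (sum_setD1_if id C h) eD.
move=> /addIr; have := half_mod_neq0 M1 NM; rewrite -/h => h0.
by do 2 case: ifP => _ //; [|move/esym]; move/eqP; rewrite (negPf h0).
Qed.

Lemma sumset_distinctP (N : nat) (A : {set 'Z_N}) :
  reflect (distinct_sums id A) (sumset_distinct A).
Proof.
apply: (iffP forallP) => [H B C|H B].
  rewrite !powersetE => BA CA e.
  by have /forallP/(_ C) := H B; rewrite BA CA e eqxx => /eqP.
apply/forallP => C; apply/implyP => /and3P[BA CA /eqP e].
by apply/eqP/H; rewrite ?powersetE.
Qed.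

(** * Counting *)

(** Used to bound the number of sets [X]: such a set is encoded by one
choice for each index [i]. *)
Lemma set_of_choices (m : nat) (T W : finType) (w0 : W) (s : 'I_m -> W -> T) (X : {set T}) :
  #|X| = m -> (forall y, y \in X -> exists i w, y = s i w) ->
  (forall i w w', s i w \in X -> s i w' \in X -> s i w = s i w') ->
  exists c : {ffun 'I_m -> W}, X = [set s i (c i) | i : 'I_m].
Proof.
move=> cX cover uniq.
exists [ffun i => if [pick w | s i w \in X] is Some w then w else w0].
apply/eqP; rewrite eqEcard cX (leq_trans (leq_imset_card _ _)) ?card_ord // andbT.
apply/subsetP => y yX; have [i [w e]] := cover y yX.
apply/imsetP; exists i; rewrite // ffunE; case: pickP => [w' w'X|/(_ w)].
  by rewrite e; apply: uniq; rewrite -?e.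
by rewrite -e yX.
Qed.

Lemma reduceN (M N : nat) (x : 'Z_N) : (1 < M)%N -> (1 < N)%N -> (M %| N)%N ->
  reduce M (- x) = - reduce M x.
Proof.
by move=> M1 N1 MN; apply/eqP; rewrite -addr_eq0 -reduceD // addNr.
Qed.

Lemma reduceMn (M N k : nat) (x : 'Z_N) : (1 < M)%N -> (1 < N)%N -> (M %| N)%N ->
  reduce M (x *+ k) = reduce M x *+ k.
Proof.
by move=> M1 N1 MN; elim: k => // k IH; rewrite !mulrS reduceD // IH.
Qed.

Lemma oddN_Zp (N : nat) (x : 'Z_N) : (1 < N)%N -> ~~ odd N -> odd (- x)%R = odd x.
Proof.
move=> N1 eN; have := oddD_Zp (- x) x N1 eN; rewrite addNr /=.
by case: (odd (- x)%R); case: (odd x).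
Qed.

Lemma even_mulrn_Zp (N k : nat) (x : 'Z_N) : (1 < N)%N -> ~~ odd N -> ~~ odd x ->
  odd (x *+ k)%R = false.
Proof.
move=> N1 eN /negPf ex; elim: k => // k IH; by rewrite mulrS oddD_Zp // ex IH.
Qed.

Definition even_pattern (m N : nat) (l : 'Z_N) (i : 'I_m) (s : bool) : 'Z_N :=
  if s then - (l *+ 2 ^ i) else l *+ 2 ^ i.

Definition half_pattern (m M N : nat) (l : 'Z_N) (i : 'I_m) (s : bool * bool) : 'Z_N :=
  even_pattern l i s.1 + (if s.2 then half_mod M N else 0).

Lemma reduce_sign_unique (m M N : nat) (X : {set 'Z_N}) (W : finType)
    (s : 'I_m -> W -> 'Z_N) (i : 'I_m) (r : 'Z_M) (w w' : W) :
  distinct_sums (reduce M) X ->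
  (forall w, reduce M (s i w) = r \/ reduce M (s i w) = - r) ->
  s i w \in X -> s i w' \in X -> s i w = s i w'.
Proof.
move=> dX sr wX w'X; apply/eqP/negPn/negP => ne.
have opp := distinct_sums_opp dX wX w'X ne.
have inj : reduce M (s i w) != reduce M (s i w').
  apply: contra ne => /eqP e; have := dX [set s i w] [set s i w'].
  by rewrite !powersetE !sub1set !big_set1 => /(_ wX w'X e)/set1_inj->.
by case: (sr w) (sr w') opp inj => -> [] ->; rewrite ?subrr ?addNr ?eqxx.
Qed.

(** An even residue modulo [N] is determined modulo [M], where
[power_of_two_structure] applies; one sign for each index is the only freedom. *)
Lemma even_parametrisation (m M N : nat) (X : {set 'Z_N}) :
  odd M -> (1 < M)%N -> N = M.*2 -> M = (2 ^ m).+1 -> (0 < m)%N -> #|X| = m ->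
  distinct_sums (reduce M) X -> (forall x : 'Z_N, x \in X -> ~~ odd x) ->
  exists l, exists c : {ffun 'I_m -> bool}, X = [set even_pattern l i (c i) | i : 'I_m].
Proof.
move=> oM M1 NM Mm m0 cX dX eX.
have N1 : (1 < N)%N by lia.
have eN : ~~ odd N by rewrite NM odd_double.
have MN : (M %| N)%N by rewrite NM -muln2 dvdn_mulr.
have cM : #|'Z_M| = (2 ^ m).+1 by rewrite card_ord Zp_cast.
have /card_gt0P[l lX] : (0 < #|X|)%N by rewrite cX.
have red i b : reduce M (even_pattern l i b) =
    if b then - (reduce M l *+ 2 ^ (i : 'I_m)) else reduce M l *+ 2 ^ i.
  by case: b; rewrite /even_pattern ?reduceN ?reduceMn.
exists l; apply: (set_of_choices false) => // [y yX|i w w' wX w'X].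
  have [i im ei] := power_of_two_structure cM cX dX lX yX.
  exists (Ordinal im), (reduce M y == - (reduce M l *+ 2 ^ i)).
  apply: (reduce_parity_inj oM M1 NM).
    by rewrite red /=; case: eqP => // ne; case: ei.
  rewrite (negPf (eX y yX)); case: eqP => _; rewrite /even_pattern ?oddN_Zp //.
    by rewrite even_mulrn_Zp // eX.
  by rewrite even_mulrn_Zp // eX.
apply: (@reduce_sign_unique _ _ _ _ _ _ _ (reduce M l *+ 2 ^ i) _ _ dX) => // b.
by rewrite red; case: b; [right|left].
Qed.

(** Without the parity constraint, each element has two lifts from modulo
[M] to modulo [N], differing by [M]; this is the second boolean. *)
Lemma half_parametrisation (m M N : nat) (X : {set 'Z_N}) :
  odd M -> (1 < M)%N -> N = M.*2 -> M = (2 ^ m).+1 -> (0 < m)%N -> #|X| = m ->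
  distinct_sums (reduce M) X ->
  exists l, exists c : {ffun 'I_m -> bool * bool},
    X = [set half_pattern M l i (c i) | i : 'I_m].
Proof.
move=> oM M1 NM Mm m0 cX dX.
have N1 : (1 < N)%N by lia.
have eN : ~~ odd N by rewrite NM odd_double.
have MN : (M %| N)%N by rewrite NM -muln2 dvdn_mulr.
have cM : #|'Z_M| = (2 ^ m).+1 by rewrite card_ord Zp_cast.
have /card_gt0P[l lX] : (0 < #|X|)%N by rewrite cX.
have red i b : reduce M (half_pattern M l i b) =
    if b.1 then - (reduce M l *+ 2 ^ (i : 'I_m)) else reduce M l *+ 2 ^ i.
  rewrite reduceD //; have -> : reduce M (if b.2 then half_mod M N else 0) = 0.
    by case: b.2 => //; apply: reduce_half_mod.
  by rewrite addr0; case: b.1; rewrite /even_pattern ?reduceN ?reduceMn.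
exists l; apply: (set_of_choices (false, false)) => // [y yX|i w w' wX w'X].
  have [i im ei] := power_of_two_structure cM cX dX lX yX.
  pose sgn := reduce M y == - (reduce M l *+ 2 ^ i).
  exists (Ordinal im), (sgn, odd y (+) odd (even_pattern l (Ordinal im) sgn)).
  apply: (reduce_parity_inj oM M1 NM).
    by rewrite red /= /sgn; case: eqP => // ne; case: ei.
  rewrite oddD_Zp //=; case: (odd y); case: (odd (even_pattern _ _ _)) => //=;
    by rewrite val_half_mod // oM.
apply: (@reduce_sign_unique _ _ _ _ _ _ _ (reduce M l *+ 2 ^ i) _ _ dX) => // b.
by rewrite red; case: b.1; [right|left].
Qed.

Lemma halve_bigN (n : nat) : (2 <= n)%N ->
  [/\ odd (bigN n %/ 2), (1 < bigN n %/ 2)%N, bigN n = (bigN n %/ 2).*2 &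
      (bigN n %/ 2 = (2 ^ n.-1).+1)%N].
Proof.
case: n => [|[|n]] // _.
have e : bigN n.+2 = (2 ^ n.+1).+1.*2 by rewrite /bigN doubleS -mul2n -expnS addn2.
rewrite e divn2 doubleK; split=> //=; first by rewrite oddX.
by rewrite ltnS expn_gt0.
Qed.

(** Both cases of the dichotomy produce a member whose removal leaves a set
with distinct sums modulo [N / 2]; this common form is what the count uses. *)
Lemma rest_distinct (n : nat) (A : {set 'Z_(bigN n)}) :
  (2 <= n)%N -> #|A| = n -> distinct_sums id A ->
  exists2 a : 'Z_(bigN n), a \in A &
    distinct_sums (reduce (bigN n %/ 2)) (A :\ a) /\
    (odd a /\ (forall b : 'Z_(bigN n), b \in A :\ a -> ~~ odd b)
     \/ a = half_mod (bigN n %/ 2) (bigN n)).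
Proof.
move=> n2 cA dA; have [oM M1 NM _] := halve_bigN n2.
have cN : (2 ^ #|A| + 2)%N = bigN n by rewrite cA.
have A2 : (1 < #|A|)%N by rewrite cA.
case: (dichotomy oM M1 NM cN A2 dA) => [[a /andP[aA oa] ua]|hA]; last first.
  by exists (half_mod (bigN n %/ 2) (bigN n)) => //; split; [apply: distinct_sums_rest_half|right].
have eA (b : 'Z_(bigN n)) : b \in A :\ a -> ~~ odd b.
  by rewrite !inE => /andP[ba bA]; apply: contraNN ba => /(ua b bA)->.
by exists a => //; split; [apply: distinct_sums_rest_odd|left].
Qed.

(** With [2 ^ (n - 1) < N], the parametrisations have at most
[N * N * 2 ^ (n - 1)] and [N * 4 ^ (n - 1)] parameters. *)
Lemma count_sumset_distinct (n : nat) : (2 <= n)%N ->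
  (#|[set A : {set 'Z_(bigN n)} | (#|A| == n) && sumset_distinct A]| <= 2 * bigN n ^ 3)%N.
Proof.
move=> n2; have [oM M1 NM Mm] := halve_bigN n2.
set M := (bigN n %/ 2)%N in oM M1 NM Mm.
pose F1 (p : 'Z_(bigN n) * 'Z_(bigN n) * {ffun 'I_n.-1 -> bool}) : {set 'Z_(bigN n)} :=
  p.1.1 |: [set even_pattern p.1.2 i (p.2 i) | i : 'I_n.-1].
pose F2 (p : 'Z_(bigN n) * {ffun 'I_n.-1 -> bool * bool}) : {set 'Z_(bigN n)} :=
  half_mod M (bigN n) |: [set half_pattern M p.1 i (p.2 i) | i : 'I_n.-1].
have N1 : (1 < bigN n)%N by lia.
have pow : (2 ^ n.-1 <= bigN n)%N by lia.
have card1 : (#|F1 @: setT| <= bigN n ^ 3)%N.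
  apply: leq_trans (leq_imset_card _ _) _.
  rewrite cardsT !card_prod card_ffun card_bool !card_ord Zp_cast //.
  by rewrite !expnS expn0 muln1 mulnA leq_mul.
have card2 : (#|F2 @: setT| <= bigN n ^ 3)%N.
  apply: leq_trans (leq_imset_card _ _) _.
  rewrite cardsT !card_prod card_ffun card_prod card_bool !card_ord Zp_cast //.
  by rewrite !expnS expn0 muln1 leq_mul // expnMn leq_mul.
apply: leq_trans (_ : #|F1 @: setT :|: F2 @: setT| <= _)%N; last first.
  by rewrite mul2n -addnn; apply: leq_trans (leq_card_setU _ _) _; apply: leq_add.
apply/subset_leq_card/subsetP => A; rewrite !inE => /andP[/eqP cA /sumset_distinctP dA].
have [a aA [dX cs]] := rest_distinct n2 cA dA.
have cX : #|A :\ a| = n.-1 by rewrite -(congr1 predn cA) [in RHS](cardsD1 a) aA.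
have m0 : (0 < n.-1)%N by lia.
case: cs => [[_ eX]|ah]; apply/orP.
  have [l [c eA]] := even_parametrisation oM M1 NM Mm m0 cX dX eX.
  by left; apply/imsetP; exists (a, l, c); rewrite // /F1 /= -eA setD1K.
have [l [c eA]] := half_parametrisation oM M1 NM Mm m0 cX dX.
by right; apply/imsetP; exists (l, c); rewrite // /F2 /= -eA -ah setD1K.
Qed.

(** * Sets of integers *)

Local Open Scope fset_scope.

Lemma intr_Zp (M : nat) (z : int) : (1 < M)%N -> z%:~R = `|(z %% M)%Z|%N%:R :> 'Z_M.
Proof.
move=> M1; rewrite {1}(divz_eq z M) rmorphD rmorphM /=.
rewrite -[(M : int)%:~R]/(M%:R) pchar_Zp // mulr0 add0r.
rewrite pmulrn gez0_abs // modz_ge0 //; lia.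
Qed.

Lemma eqZp_int (M : nat) (x y : int) : (1 < M)%N ->
  (x%:~R = y%:~R :> 'Z_M) <-> (x = y %[mod M])%Z.
Proof.
move=> M1; rewrite !intr_Zp //; split=> [/(eqZp_nat _ _ M1)|->//].
have lt z : (`|(z %% M)%Z| < M)%N by have := @ltz_pmod z M; have := @modz_ge0 z M; lia.
rewrite !modn_small // => e; have := @modz_ge0 x M; have := @modz_ge0 y M; lia.
Qed.

Lemma reduce_intr (M N : nat) (z : int) : (1 < M)%N -> (1 < N)%N -> (M %| N)%N ->
  reduce M (z%:~R : 'Z_N) = z%:~R.
Proof.
move=> M1 N1 MN; rewrite /reduce [in LHS]intr_Zp // val_Zp_nat // natr_mod_Zp //.
have MN0 : ((N : int)%:~R = 0 :> 'Z_M).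
  by have /dvdnP[q ->] := MN; rewrite -[LHS]/((q * M)%:R) natrM pchar_Zp // mulr0.
rewrite [in RHS](divz_eq z N) rmorphD rmorphM /= MN0 mulr0 add0r.
rewrite pmulrn gez0_abs // modz_ge0 //; lia.
Qed.

Lemma eq_modz_mull (k M : nat) (x y : int) : coprime k M ->
  (k%:Z * x = k%:Z * y %[mod M])%Z <-> (x = y %[mod M])%Z.
Proof.
move=> kM; split=> [/eqP|e]; last by rewrite -modzMmr e modzMmr.
by rewrite eqz_mod_dvd -mulrBr Gauss_dvdzr ?coprimezE 1?coprime_sym // -eqz_mod_dvd => /eqP.
Qed.

Definition scaled_residues (k N : nat) (S : {fset int}) : {set 'Z_N} :=
  [set y in [seq (k%:Z * x)%:~R : 'Z_N | x <- S]].

Lemma scaled_residuesP (k N : nat) (S : {fset int}) (y : 'Z_N) :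
  reflect (exists2 x, x \in S & y = (k%:Z * x)%:~R) (y \in scaled_residues k N S).
Proof. by rewrite inE; apply: mapP. Qed.

Lemma sum_scaled_residues (k M N : nat) (S : {fset int}) :
  (1 < M)%N -> (1 < N)%N -> (M %| N)%N ->
  {in S &, injective (fun x : int => (k%:Z * x)%:~R : 'Z_N)} ->
  \sum_(y in scaled_residues k N S) reduce M y = (k%:Z * \sum_(x <- S) x)%:~R.
Proof.
move=> M1 N1 MN inj.
rewrite (eq_bigl (mem [seq (k%:Z * x)%:~R : 'Z_N | x <- S])); last by move=> y; rewrite inE.
rewrite -big_uniq ?map_inj_in_uniq ?fset_uniq // big_map mulr_sumr rmorph_sum.
by apply: eq_bigr => x _; rewrite reduce_intr.
Qed.

Lemma distinct_scaled_residues (k M N : nat) (S : {fset int}) :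
  (1 < M)%N -> (1 < N)%N -> (M %| N)%N -> coprime k M ->
  {in S &, injective (fun x : int => (k%:Z * x)%:~R : 'Z_N)} ->
  intset_sumset_distinct M S <-> distinct_sums (reduce M) (scaled_residues k N S).
Proof.
move=> M1 N1 MN kM inj.
have sumE (B : {fset int}) : B `<=` S ->
    \sum_(y in scaled_residues k N B) reduce M y = (k%:Z * \sum_(x <- B) x)%:~R.
  by move=> /fsubsetP BS; apply: sum_scaled_residues => // x y /BS xS /BS yS; apply: inj.
have memE (B : {fset int}) x : B `<=` S -> x \in S ->
    ((k%:Z * x)%:~R \in scaled_residues k N B) = (x \in B).
  move=> /fsubsetP BS xS; apply/scaled_residuesP/idP => [[z zB]|xB]; last by exists x.
  by move/inj => -> //; apply: BS.
split=> dS B C.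
  rewrite !powersetE => BX CX.
  pose pre (D : {set 'Z_N}) := [fset x in S | (k%:Z * x)%:~R \in D].
  have preS D : pre D `<=` S by apply/fsubsetP => x; rewrite !inE => /andP[].
  have preK (D : {set 'Z_N}) : D \subset scaled_residues k N S -> scaled_residues k N (pre D) = D.
    move=> /subsetP DX; apply/setP => y; apply/scaled_residuesP/idP.
      by case=> x; rewrite !inE => /andP[_ xD] ->.
    move=> yD; have /scaled_residuesP[x xS e] := DX y yD.
    by exists x => //; rewrite !inE xS -e.
  rewrite -{1}(preK B) // -{1}(preK C) // !sumE // => /(eqZp_int _ _ M1)/(eq_modz_mull _ _ kM).
  by move/(dS _ _ (preS B) (preS C)) => e; rewrite -(preK B) // e preK.
move=> BS CS e.
have sub (D : {fset int}) : D `<=` S -> scaled_residues k N D \in powerset (scaled_residues k N S).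
  move=> /fsubsetP DS; rewrite powersetE; apply/subsetP => y /scaled_residuesP[x xD ->].
  by apply/scaled_residuesP; exists x => //; apply: DS.
have : scaled_residues k N B = scaled_residues k N C.
  apply: dS; rewrite ?sub // !sumE //; apply/eqZp_int => //.
  by apply/eq_modz_mull.
move=> eBC; apply/fsetP => x; have [xS|xS] := boolP (x \in S).
  by rewrite -(memE _ _ BS xS) eBC memE.
have out (D : {fset int}) : D `<=` S -> x \in D = false.
  by move=> /fsubsetP DS; apply: contraNF xS => /DS.
by rewrite !out.
Qed.

(** Both alternatives of the classification use it, (i) with [k = 2] and (ii)
with [k = 1]. As [k] is invertible modulo [M], multiplying by it does not affect
distinctness. *)
Lemma integer_lift (k M N : nat) (X : {set 'Z_N}) :
  (1 < M)%N -> (1 < N)%N -> (M %| N)%N -> coprime k M -> (0 < k)%N -> (k %| N)%N ->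
  (exists S : {fset int}, intset_sumset_distinct M S /\ X = scaled_residues k N S) <->
  distinct_sums (reduce M) X /\ (forall y : 'Z_N, y \in X -> (k %| y)%N).
Proof.
move=> M1 N1 MN kM k0 kN; split.
  case=> S [dS ->]; split.
    apply/distinct_scaled_residues => // x y xS yS /(congr1 (reduce M)).
    rewrite !reduce_intr // => /(eqZp_int _ _ M1)/(eq_modz_mull _ _ kM) e.
    have := dS [fset x] [fset y]; rewrite !fsub1set !big_seq_fset1.
    by move=> /(_ xS yS e)/fsetP/(_ x); rewrite !inE eqxx => /esym/eqP.
  move=> y /scaled_residuesP[x xS ->]; rewrite intr_Zp // val_Zp_nat //.
  have : (k %| (k%:Z * x) %% N)%Z.
    by rewrite /modz rpredB //; [apply: dvdz_mulr|apply: dvdz_mull].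
  by rewrite dvdzE /= => h; rewrite /dvdn modn_dvdm.
case=> dX kX.
pose g (y : 'Z_N) : int := (y %/ k)%N%:Z.
have gK y : y \in X -> (k%:Z * g y)%:~R = y.
  move=> /kX ky; rewrite /g -PoszM mulnC divnK //.
  by rewrite -[LHS]/(y%:R) natr_Zp.
pose S := [fset g y | y in X].
have eX : X = scaled_residues k N S.
  apply/setP => y; apply/idP/scaled_residuesP => [yX|].
    by exists (g y); rewrite ?gK // in_imfset.
  by case=> x /imfsetP[/= z zX ->] ->; rewrite gK.
exists S; split=> //; apply/(@distinct_scaled_residues k M N S M1 N1 MN kM); last by rewrite -eX.
move=> x x' /imfsetP[/= y yX ->] /imfsetP[/= y' yX' ->].
by rewrite !gK // => ->.
Qed.

Lemma residuesU1 (N : nat) (a : int) (S : {fset int}) :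
  residues N (a |` S) = a%:~R |: residues N S.
Proof.
apply/setP => y; rewrite !inE; apply/mapP/orP.
  case=> x; rewrite !inE => /orP[/eqP->|xS] ->; first by left.
  by right; apply/mapP; exists x.
case=> [/eqP->|/mapP[x xS ->]]; first by exists a; rewrite ?fset1U1.
by exists x => //; rewrite fset1Ur.
Qed.

Lemma residues_double (N : nat) (S : {fset int}) :
  residues N [fset 2 * x | x in S] = scaled_residues 2 N S.
Proof.
apply/setP => y; apply/idP/scaled_residuesP.
  by rewrite inE => /mapP[z /imfsetP[/= x xS ->] ->]; exists x.
by case=> x xS ->; rewrite inE; apply/mapP; exists (2 * x) => //; apply/imfsetP; exists x.
Qed.

Lemma residues_scaled1 (N : nat) (S : {fset int}) : residues N S = scaled_residues 1 N S.
Proof.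
by apply/setP => y; rewrite !inE; congr (_ \in _); apply: eq_map => x; rewrite mul1r.
Qed.

Lemma odd_intr_Zp (N : nat) (a : int) : (1 < N)%N -> ~~ odd N ->
  odd (a%:~R : 'Z_N) = ~~ (2 %| a)%Z.
Proof.
move=> N1 eN; rewrite intr_Zp // val_Zp_nat // odd_mod ?(negPf eN) //.
have : (2 %| (a %/ N)%Z * N)%Z by apply: dvdz_mull; rewrite dvdzE /= dvdn2.
rewrite [in RHS](divz_eq a N) => d; rewrite rpredDl //.
by rewrite dvdzE /= dvdn2 negbK.
Qed.

Lemma sumset_distinct_iff (n : nat) (A : {set 'Z_(bigN n)}) : (2 <= n)%N -> #|A| = n ->
  sumset_distinct A <->
       ((exists (a : int) (A' : {fset int}),
           [/\ ~~ (2 %| a)%Z,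
               intset_sumset_distinct (bigN n %/ 2) A' &
               A = residues (bigN n) (a |` [fset 2 * x | x in A'])])
        \/
        (exists A' : {fset int},
           intset_sumset_distinct (bigN n %/ 2) A' /\
           A = residues (bigN n) ((bigN n %/ 2)%N%:Z |` A'))).
Proof.
move=> n2 cA; have [oM M1 NM _] := halve_bigN n2.
set M := (bigN n %/ 2)%N in oM M1 NM *; set N := bigN n in A cA NM *.
have N1 : (1 < N)%N by lia.
have eN : ~~ odd N by rewrite NM odd_double.
have MN : (M %| N)%N by rewrite NM -muln2 dvdn_mulr.
have N2 : (2 %| N)%N by rewrite dvdn2.
have cop2 : coprime 2 M by rewrite coprime2n.
have lift1 X := @integer_lift 1 M N X M1 N1 MN (coprime1n _) isT (dvd1n _).
have lift2 X := @integer_lift 2 M N X M1 N1 MN cop2 isT N2.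
split.
  move=> /sumset_distinctP/(rest_distinct n2 cA)[a aA [dA]].
  rewrite -/M -/N in a aA dA *; case=> [[oa ev]|ah]; [left|right].
    have [|S [dS eS]] := (lift2 (A :\ a)).2.
      by split=> // y /ev; rewrite dvdn2.
    exists (a : nat)%:Z, S; split=> //; first by rewrite dvdzE /= dvdn2 negbK.
    rewrite residuesU1 residues_double -eS.
    by rewrite -[(a : nat)%:Z%:~R]/((a : nat)%:R) natr_Zp setD1K.
  have [|S [dS eS]] := (lift1 (A :\ a)).2; first by split=> // y _; rewrite dvd1n.
  exists S; split=> //; rewrite residuesU1 residues_scaled1 -eS.
  by rewrite -[_%:Z%:~R]/(half_mod M N) -ah setD1K.
move=> H; apply/sumset_distinctP; case: H => [[a [S [oa dS ->]]]|[S [dS ->]]].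
  rewrite residuesU1 residues_double; set X := scaled_residues 2 N S.
  have [dX eX] := (lift2 X).1 (ex_intro _ S (conj dS erefl)).
  have evX (b : 'Z_N) : b \in X -> ~~ odd b by move/eX; rewrite dvdn2.
  have oa' : odd (a%:~R : 'Z_N) by rewrite odd_intr_Zp.
  have aX : a%:~R \notin X by apply: contraL oa'; apply: evX.
  by apply: (distinct_sums_add_odd oM M1 NM oa'); rewrite setU1K.
rewrite residuesU1 residues_scaled1; set X := scaled_residues 1 N S.
have [dX _] := (lift1 X).1 (ex_intro _ S (conj dS erefl)).
rewrite -[_%:Z%:~R]/(half_mod M N).
have hX : half_mod M N \notin X.
  by apply/negP => /(distinct_sums_neq0 dX); rewrite reduce_half_mod ?eqxx.
by apply: (distinct_sums_add_half M1 NM); rewrite setU1K.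
Qed.

Theorem theorem1p7 :
  (forall (n : nat) (hn : (2 <= n)%N) (A : {set 'Z_(bigN n)}) (hA : #|A| = n),
     sumset_distinct A <->
       ((exists (a : int) (A' : {fset int}),
           [/\ ~~ (2 %| a)%Z,
               intset_sumset_distinct (bigN n %/ 2) A' &
               A = residues (bigN n) (a |` [fset 2 * x | x in A'])])
        \/
        (exists A' : {fset int},
           intset_sumset_distinct (bigN n %/ 2) A' /\
           A = residues (bigN n) ((bigN n %/ 2)%N%:Z |` A'))))
  /\
  (exists K : nat, forall n : nat, (2 <= n)%N ->
     (#|[set A : {set 'Z_(bigN n)} | (#|A| == n) && sumset_distinct A]|
        <= K * bigN n ^ 3)%N).
Proof.
split; first by move=> n hn A hA; apply: sumset_distinct_iff.
by exists 2%N; apply: count_sumset_distinct.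
Qed.
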